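(* The sequences $\{s_n^k(123,321)\}_{n\ge 0}$ are: $\{s_n^0(123,321)\}_{n\ge 0}=1,0,1,2,4,0,0,\dots$ (that is, the values at $n=0,1,2,3,4$ are $1,0,1,2,4$, and $s_n^0(123,321)=0$ for all $n\ge 5$); $\{s_n^1(123,321)\}_{n\ge 0}=0,1,0,2,0,0,\dots$ (the values at $n=0,1,2,3$ are $0,1,0,2$, and $s_n^1(123,321)=0$ for all $n\ge 4$); $\{s_n^2(123,321)\}_{n\ge 0}=0,0,1,0,0,\dots$ (the values at $n=0,1,2$ are $0,0,1$, and $s_n^2(123,321)=0$ for all $n\ge 3$); and $s_n^k(123,321)=0$ for all $3\le k\le n$.
   Context: $S_n$ denotes the set of permutations of $\{1,\dots,n\}$ written in one-line notation $\pi=\pi_1\pi_2\cdots\pi_n$ ($S_0$ consists of the single empty permutation). For $\alpha\in S_m$, $\pi\in S_n$ contains the pattern $\alpha$ if there are indices $i_1<i_2<\dots<i_m$ such that $\pi_{i_1}\pi_{i_2}\cdots\pi_{i_m}$ is order-isomorphic to $\alpha$; otherwise $\pi$ avoids $\alpha$. For a set $T$ of patterns, $S_n^k(T)$ is the set of $\pi\in S_n$ that have exactly $k$ fixed points (indices $i$ with $\pi_i=i$) and avoid every pattern in $T$; $s_n^k(T)=|S_n^k(T)|$, and $s_n^k(T)=0$ if $k<0$ or $k>n$. The braces around $T$ are omitted, e.g. $s_n^k(123,321)=s_n^k(\{123,321\})$. *)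

(* Defs.v *)
From HB Require Import structures.
From mathcomp Require Import all_boot all_fingroup.

Set Implicit Arguments.
Unset Strict Implicit.
Unset Printing Implicit Defensive.

(* A permutation of {1, ..., n} is an element of 'S_n, a permutation of
   {0, ..., n - 1}: positions and values are both shifted down by one, which
   changes neither order-isomorphism nor fixed points. *)
Definition oneline n (p : 'S_n) : seq nat := [seq (p i).+1 | i <- enum 'I_n].

(* f lists the positions i_1 < ... < i_m of an occurrence of a in p. *)
Definition contains m n (a : 'S_m) (p : 'S_n) : bool :=
  [exists f : {ffun 'I_m -> 'I_n},
    [forall i : 'I_m, forall j : 'I_m, (i < j) ==> (f i < f j)] &&
    [forall i : 'I_m, forall j : 'I_m, (p (f i) < p (f j)) == (a i < a j)]].

Definition avoids m n (a : 'S_m) (p : 'S_n) : bool := ~~ contains a p.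

Definition pattern : Type := {m : nat & 'S_m}.

Definition fixed_points n (p : 'S_n) : {set 'I_n} := [set i | p i == i].

(* S_n^k(T), with the finite set T of patterns given by a list. *)
Definition avoiders (T : seq pattern) (n k : nat) : {set 'S_n} :=
  [set p : 'S_n | (#|fixed_points p| == k) &&
                  all (fun a : pattern => avoids (tagged a) p) T].

Definition num_avoiders (T : seq pattern) (n k : nat) : nat :=
  #|avoiders T n k|.

Definition perm123 : 'S_3 := 1%g.
Definition perm321 : 'S_3 := perm (@rev_ord_inj 3).

Lemma oneline_perm123 : oneline perm123 = [:: 1; 2; 3].
Proof. by rewrite /oneline !enum_ordSl enum_ord0 /= !perm1. Qed.

Lemma oneline_perm321 : oneline perm321 = [:: 3; 2; 1].
Proof. by rewrite /oneline !enum_ordSl enum_ord0 /= !permE. Qed.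

Definition pat123 : pattern := existT (fun m : nat => 'S_m) 3 perm123.
Definition pat321 : pattern := existT (fun m : nat => 'S_m) 3 perm321.

(* Main.v *)
Require Import Defs.
From HB Require Import structures.
From mathcomp Require Import all_boot all_fingroup.
From mathcomp Require Import zify.

Set Implicit Arguments.
Unset Strict Implicit.
Unset Printing Implicit Defensive.

(** The statement is the smallest case of the Erdős–Szekeres theorem together
    with a finite count.

    Attach to each position of a permutation two bits: whether some earlier
    value is smaller, and whether some earlier value is larger.  If two
    positions i < j carry the same bits, the bit describing how p j compares
    with p i is set at j, hence also at i, and the earlier value that
    witnesses it at i extends (p i, p j) to a monotone triple.  A permutation
    avoiding 123 and 321 therefore has pairwise distinct labels, of which
    there are only four, so it has length at most 4 ([avoiders_short]).

    For n <= 4 the counts are computed.  Sets of permutations of type 'S_n do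
    not reduce, so [num_avoidersE] transports the count along [oneline] to the
    explicit list of rearrangements of 1, ..., n, where both the number of
    fixed points and the presence of a monotone triple can be evaluated. *)

(** * Occurrences of patterns of length three *)

Lemma ltn_permN n (p : 'S_n) (i j : 'I_n) : i != j -> (p j < p i) = ~~ (p i < p j).
Proof.
move=> ne_ij; rewrite -leqNgt ltn_neqAle; case: eqP => // /val_inj/perm_inj eji.
by rewrite eji eqxx in ne_ij.
Qed.

(** Three comparisons decide order-isomorphism, because those in the opposite
    direction are their negations. *)
Lemma contains3P n (a : 'S_3) (p : 'S_n) :
  let i0 : 'I_3 := inord 0 in let i1 : 'I_3 := inord 1 in
  let i2 : 'I_3 := inord 2 in
  reflect (exists i j k : 'I_n, [/\ i < j, j < k,
             (p i < p j) = (a i0 < a i1), (p j < p k) = (a i1 < a i2)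
             & (p i < p k) = (a i0 < a i2)])
          (contains a p).
Proof.
move=> i0 i1 i2.
have v0 : i0 = 0 :> nat by rewrite inordK.
have v1 : i1 = 1 :> nat by rewrite inordK.
have v2 : i2 = 2 :> nat by rewrite inordK.
apply: (iffP existsP) => [[f /andP[/forallP incf /forallP ordf]]|].
  exists (f i0), (f i1), (f i2).
  have inc (x y : 'I_3) : x < y -> f x < f y.
    by move=> lt_xy; have /forallP/(_ y)/implyP := incf x; apply.
  have ord (x y : 'I_3) : (p (f x) < p (f y)) = (a x < a y).
    by have /forallP/(_ y)/eqP := ordf x.
  by split; rewrite ?ord //; apply: inc; rewrite ?v0 ?v1 ?v2.
case=> i [j [k [lt_ij lt_jk pij pjk pik]]].
have lt_ik := ltn_trans lt_ij lt_jk.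
have opp (x y : 'I_n) (u v : 'I_3) : x < y -> u < v ->
    (p x < p y) = (a u < a v) -> (p y < p x) = (a v < a u).
  move=> lt_xy lt_uv eq_xy.
  by rewrite (@ltn_permN _ p x y) ?(@ltn_permN _ a u v) ?eq_xy //;
    rewrite neq_ltn ?lt_xy ?lt_uv.
exists [ffun x : 'I_3 => nth i [:: i; j; k] x].
have case3 (P : 'I_3 -> Prop) : P i0 -> P i1 -> P i2 -> forall x, P x.
  move=> P0 P1 P2 x.
  have: x \in [:: i0; i1; i2].
    by rewrite !inE -!val_eqE /= v0 v1 v2; case: x => [[|[|[|]]]].
  by rewrite !inE => /or3P[] /eqP->.
apply/andP; split.
  by apply/forallP; elim/case3; apply/forallP; elim/case3;
    rewrite !ffunE ?v0 ?v1 ?v2 /=.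
have [p10 p21 p20] : [/\ (p j < p i) = (a i1 < a i0),
    (p k < p j) = (a i2 < a i1) & (p k < p i) = (a i2 < a i0)].
  by split; apply: opp; rewrite ?v0 ?v1 ?v2.
by apply/forallP; elim/case3; apply/forallP; elim/case3;
  rewrite !ffunE ?v0 ?v1 ?v2 /= ?ltnn ?pij ?pjk ?pik ?p10 ?p21 ?p20.
Qed.

Definition monotone_triple (r : rel nat) n (p : 'S_n) : Prop :=
  exists i j k : 'I_n, [/\ i < j, j < k, r (p i) (p j) & r (p j) (p k)].

Lemma contains123P n (p : 'S_n) :
  reflect (monotone_triple ltn p) (contains perm123 p).
Proof.
apply: (iffP (contains3P _ _)); rewrite !perm1 !inordK //=.
  by case=> i [j [k [ij jk pij pjk _]]]; exists i, j, k.
case=> i [j [k [ij jk /= pij pjk]]]; exists i, j, k; split => //.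
by rewrite (ltn_trans pij pjk).
Qed.

Lemma contains321P n (p : 'S_n) :
  reflect (monotone_triple gtn p) (contains perm321 p).
Proof.
apply: (iffP (contains3P _ _)); rewrite !permE /= !inordK //=.
  case=> i [j [k [ij jk pij pjk _]]]; exists i, j, k; split => //=.
    by rewrite (@ltn_permN _ p i j) ?pij // neq_ltn ij.
  by rewrite (@ltn_permN _ p j k) ?pjk // neq_ltn jk.
case=> i [j [k [ij jk /= pij pjk]]]; exists i, j, k.
by split => //; lia.
Qed.

(** * Length at least five *)

(** Seidenberg's labelling argument for the Erdős–Szekeres theorem: one bit per
    direction suffices because monotone subsequences have length at most two. *)
Lemma avoids_monotone_short n (p : 'S_n) :
  avoids perm123 p -> avoids perm321 p -> n <= 4.
Proof.
move=> /contains123P no123 /contains321P no321.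
pose earlier (r : rel nat) (j : 'I_n) := [exists i : 'I_n, (i < j) && r (p i) (p j)].
pose label j := (earlier ltn j, earlier gtn j).
have extend (r : rel nat) (i j : 'I_n) : i < j -> r (p i) (p j) ->
    earlier r i = earlier r j -> monotone_triple r p.
  move=> lt_ij rij eq_ij.
  have /existsP[h /andP[lt_hi rhi]] : earlier r i.
    by rewrite eq_ij; apply/existsP; exists i; rewrite lt_ij.
  by exists h, i, j.
have no_repeat (i j : 'I_n) : i < j -> label i <> label j.
  move=> lt_ij [eq_lt eq_gt]; case: (ltngtP (p i) (p j)) => [pij|pij|].
  - exact/no123/extend/eq_lt.
  - exact/no321/extend/eq_gt.
  - by move/val_inj/perm_inj=> eq_ij; rewrite eq_ij ltnn in lt_ij.
have inj_label : injective label.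
  move=> i j eq_ij; apply: val_inj; case: (ltngtP i j) => // lt_ij.
    by case: (no_repeat _ _ lt_ij).
  by case: (no_repeat _ _ lt_ij).
by have := leq_card _ inj_label; rewrite card_ord card_prod card_bool.
Qed.

Lemma avoiders_short n k :
  5 <= n -> num_avoiders [:: pat123; pat321] n k = 0.
Proof.
move=> n_ge5; apply: eq_card0 => p; rewrite !inE /=.
apply/negP => /and4P[_ av123 av321 _].
by have := avoids_monotone_short av123 av321; rewrite leqNgt n_ge5.
Qed.

(** * Length at most four *)

Definition word_triple (r : rel nat) (w : seq nat) : bool :=
  has (fun k => has (fun j => r (nth 0 w j) (nth 0 w k) &&
      has (fun i => r (nth 0 w i) (nth 0 w j)) (iota 0 j)) (iota 0 k))
    (iota 0 (size w)).

Definition word_fixed_points (w : seq nat) : nat :=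
  count (fun i => nth 0 w i == i.+1) (iota 0 (size w)).

Lemma size_oneline n (p : 'S_n) : size (oneline p) = n.
Proof. by rewrite size_map size_enum_ord. Qed.

Lemma nth_oneline n (p : 'S_n) (i : 'I_n) : nth 0 (oneline p) i = (p i).+1.
Proof. by rewrite (nth_map i) ?nth_ord_enum // size_enum_ord. Qed.

Lemma oneline_inj n : injective (@oneline n).
Proof.
move=> p q eq_pq; apply/permP => i; apply/val_inj/succn_inj.
by rewrite -!nth_oneline eq_pq.
Qed.

(** [oneline] shifts the values up by one, so [r] has to be invariant under
    that shift. *)
Lemma word_tripleP (r : rel nat) n (p : 'S_n) :
    (forall x y, r x.+1 y.+1 = r x y) ->
  reflect (monotone_triple r p) (word_triple r (oneline p)).
Proof.
move=> rS; rewrite /word_triple size_oneline; apply: (iffP hasP).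
  case=> k; rewrite mem_iota /= add0n => lt_kn.
  case/hasP=> j; rewrite mem_iota /= add0n => lt_jk /andP[rjk].
  case/hasP=> i; rewrite mem_iota /= add0n => lt_ij rij.
  have lt_jn := ltn_trans lt_jk lt_kn; have lt_in := ltn_trans lt_ij lt_jn.
  exists (Ordinal lt_in), (Ordinal lt_jn), (Ordinal lt_kn).
  by split; rewrite // -rS -!nth_oneline.
case=> i [j [k [lt_ij lt_jk rij rjk]]].
exists (k : nat); first by rewrite mem_iota /=.
apply/hasP; exists (j : nat); first by rewrite mem_iota.
rewrite !nth_oneline rS rjk; apply/hasP; exists (i : nat).
  by rewrite mem_iota.
by rewrite nth_oneline rS.
Qed.

Lemma word_fixed_pointsE n (p : 'S_n) :
  word_fixed_points (oneline p) = #|fixed_points p|.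
Proof.
rewrite /word_fixed_points size_oneline -val_enum_ord count_map.
rewrite cardsE cardE enumT size_filter -enumT; apply: eq_count => i /=.
by rewrite nth_oneline eqSS.
Qed.

(** The one-line words of 'S_n are distinct rearrangements of 1, ..., n, and
    there are n! of both, so nothing is missed. *)
Lemma perm_oneline n :
  perm_eq [seq oneline p | p <- enum 'S_n] (permutations (iota 1 n)).
Proof.
have uniqL : uniq [seq oneline p | p <- enum 'S_n].
  by rewrite (map_inj_uniq (@oneline_inj n)) enum_uniq.
have sub : {subset [seq oneline p | p <- enum 'S_n] <= permutations (iota 1 n)}.
  move=> _ /mapP[p _ ->]; rewrite mem_permutations.
  have uniq_p : uniq (oneline p).
    rewrite map_inj_uniq ?enum_uniq // => i j /succn_inj/val_inj.
    exact: perm_inj.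
  have sub_p : {subset oneline p <= iota 1 n}.
    by move=> _ /mapP[i _ ->]; rewrite mem_iota /= add1n !ltnS ltn_ord.
  have [|_ eq_p] := uniq_min_size uniq_p sub_p.
    by rewrite size_iota size_oneline.
  exact: uniq_perm uniq_p (iota_uniq 1 n) eq_p.
have [|_ eqm] := uniq_min_size uniqL sub.
  rewrite size_permutations ?iota_uniq // size_iota size_map -cardE.
  by rewrite card_Sn.
exact: uniq_perm uniqL (permutations_uniq _) eqm.
Qed.

Lemma num_avoidersE n k :
  num_avoiders [:: pat123; pat321] n k =
  count (fun w => [&& word_fixed_points w == k, ~~ word_triple ltn w
                    & ~~ word_triple gtn w]) (permutations (iota 1 n)).
Proof.
rewrite -(seq.permP (perm_oneline n)) count_map.
rewrite /num_avoiders cardE size_filter -enumT.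
apply: eq_count => p; rewrite /= inE /= andbT word_fixed_pointsE /avoids; congr [&& _, ~~ _ & ~~ _].
  by apply/contains123P/word_tripleP.
by apply/contains321P/word_tripleP.
Qed.

Theorem theorem2p1 :
  let s := num_avoiders [:: pat123; pat321] in
  [/\ [seq s n 0 | n <- [:: 0; 1; 2; 3; 4]] = [:: 1; 0; 1; 2; 4]
        /\ (forall n : nat, 5 <= n -> s n 0 = 0),
      [seq s n 1 | n <- [:: 0; 1; 2; 3]] = [:: 0; 1; 0; 2]
        /\ (forall n : nat, 4 <= n -> s n 1 = 0),
      [seq s n 2 | n <- [:: 0; 1; 2]] = [:: 0; 0; 1]
        /\ (forall n : nat, 3 <= n -> s n 2 = 0)
    & forall n k : nat, 3 <= k -> k <= n -> s n k = 0].
Proof.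
move=> s; rewrite /s /= !num_avoidersE.
split; [split | split | split |].
- by vm_compute.
- by move=> n; apply: avoiders_short.
- by vm_compute.
- move=> n; rewrite leq_eqVlt => /predU1P[<-|]; last exact: avoiders_short.
  by rewrite num_avoidersE; vm_compute.
- by vm_compute.
- case=> [|[|[|[|[|n]]]]] // _; last exact: avoiders_short.
    by rewrite num_avoidersE; vm_compute.
  by rewrite num_avoidersE; vm_compute.
- case=> [|[|[|[|[|n]]]]] [|[|[|[|[|k]]]]] // _ _;
    first [exact: avoiders_short | by rewrite num_avoidersE; vm_compute].
Qed.
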